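(* For all natural numbers $n$ and $k$ with $k\le n$, $\mathrm{E}_k^+=\mathcal{E}_k^n$ and $\mathrm{U}_k^+=\mathcal{U}_k^n$.
   Context: Formulas are those of a first-order language with logical constants $\forall,\exists,\to,\land,\lor,\perp$. Natural numbers may be $0$. Classes $\mathcal{E}^n_k,\mathcal{U}^n_k,\mathcal{D}^n_k$. For each $n$, $\mathcal{D}^n_0=\mathcal{E}^n_0=\mathcal{U}^n_0$ is the set of quantifier-free formulas. Given $\mathcal{E}^n_k$ and $\mathcal{U}^n_k$, put $\mathcal{D}^n_k=\mathcal{E}^n_k\cup\mathcal{U}^n_k$; then $\mathcal{E}^n_{k+1}$ and $\mathcal{U}^n_{k+1}$ are simultaneously inductively generated by the following clauses, where $D$ ranges over $\mathcal{D}^n_k$, $E,E'$ over $\mathcal{E}^n_{k+1}$, and $U,U'$ over $\mathcal{U}^n_{k+1}$: - if $n>k$: $D,\ E\land E',\ E\lor E',\ U\to E,\ \exists xE\in\mathcal{E}^n_{k+1}$; and $D,\ U\land U',\ U\lor U',\ E\to U,\ \forall xU\in\mathcal{U}^n_{k+1}$; - if $n=k$: $D,\ E\land E',\ E\lor E',\ D\to E,\ \exists xE\in\mathcal{E}^n_{k+1}$; and $D,\ U\land U',\ U\lor D,\ D\lor U,\ E\to U,\ \forall xU\in\mathcal{U}^n_{k+1}$; - if $n<k$: with $D_0$ ranging over $\mathcal{D}^n_n$ and $E_1$ over $\mathcal{E}^n_{n+1}$: $D,\ E\land E',\ E\lor E_1,\ E_1\lor E,\ D_0\to E,\ \exists xE\in\mathcal{E}^n_{k+1}$;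 and $D,\ U\land U',\ U\lor D_0,\ D_0\lor U,\ E_1\to U,\ \forall xU\in\mathcal{U}^n_{k+1}$. Classes $\mathrm{E}_k^+,\mathrm{U}_k^+$. An alternation path is a finite sequence in which the symbols $+$ and $-$ alternate; $l(s)$ is its length, $i(s)$ its first symbol (undefined, hence neither $+$ nor $-$, for the empty path $\langle\rangle$), and $s^\perp$ is $s$ with $+$ and $-$ switched. Define $\mathrm{Alt}(\varphi)$: if $\varphi$ is quantifier-free, $\mathrm{Alt}(\varphi)=\{\langle\rangle\}$; otherwise $\mathrm{Alt}(\varphi_1\land\varphi_2)=\mathrm{Alt}(\varphi_1\lor\varphi_2)=\mathrm{Alt}(\varphi_1)\cup\mathrm{Alt}(\varphi_2)$; $\mathrm{Alt}(\varphi_1\to\varphi_2)=\{s^\perp\mid s\in\mathrm{Alt}(\varphi_1)\}\cup\mathrm{Alt}(\varphi_2)$; $\mathrm{Alt}(\forall x\varphi_1)=\{s\in\mathrm{Alt}(\varphi_1)\mid i(s)=-\}\cup\{-s\mid s\in\mathrm{Alt}(\varphi_1),\,i(s)\neq-\}$; $\mathrm{Alt}(\exists x\varphi_1)=\{s\in\mathrm{Alt}(\varphi_1)\mid i(s)=+\}\cup\{+s\mid s\in\mathrm{Alt}(\varphi_1),\,i(s)\neq+\}$. Let $\deg(\varphi)=\max\{l(s)\mid s\in\mathrm{Alt}(\varphi)\}$, $\mathrm{F}_k=\{\varphi\mid\deg(\varphi)=k\}$, $\mathrm{E}_0=\mathrm{U}_0=\mathrm{F}_0$, $\mathrm{E}_{k+1}$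 (resp. $\mathrm{U}_{k+1}$) the set of $\varphi\in\mathrm{F}_{k+1}$ such that $i(s)=+$ (resp. $i(s)=-$) for all $s\in\mathrm{Alt}(\varphi)$ with $l(s)=k+1$. Then $\mathrm{E}_k^+=\mathrm{E}_k\cup\bigcup_{i<k}\mathrm{F}_i$ and $\mathrm{U}_k^+=\mathrm{U}_k\cup\bigcup_{i<k}\mathrm{F}_i$. *)

(* Defs.v *)
From mathcomp Require Import all_boot.

Set Implicit Arguments.
Unset Strict Implicit.
Unset Printing Implicit Defensive.

(* Equality, if the language has it, is one of the binary predicate symbols. *)
Record language := Language {
  func : Type;
  func_arity : func -> nat;
  pred_sym : Type;
  pred_arity : pred_sym -> nat
}.

Inductive term (L : language) : Type :=
| Var of nat
| App (f : func L) of {ffun 'I_(func_arity f) -> term L}.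

(* Variables, bound ones included, are named by natural numbers. *)
Inductive formula (L : language) : Type :=
| Bot
| Atom (P : pred_sym L) of {ffun 'I_(pred_arity P) -> term L}
| And of formula L & formula L
| Or of formula L & formula L
| Imp of formula L & formula L
| All of nat & formula L
| Ex of nat & formula L.

Arguments Bot {L}.

Fixpoint quantifier_free (L : language) (phi : formula L) : bool :=
  match phi with
  | Bot | Atom _ _ => true
  | And phi1 phi2 | Or phi1 phi2 | Imp phi1 phi2 =>
      quantifier_free phi1 && quantifier_free phi2
  | All _ _ | Ex _ _ => false
  end.

(* calE n k, calU n k and calD n k are the classes E^n_k, U^n_k and D^n_k.
   All levels k are generated at once: a clause for level k.+1 refers only to
   levels up to k.+1 (in the case n < k, to levels n and n.+1 <= k), so this
   agrees with generating the levels one after the other. *)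
Inductive calE (L : language) (n : nat) : nat -> formula L -> Prop :=
| calE_qf phi : quantifier_free phi -> calE n 0 phi
| calE_D k phi : calD n k phi -> calE n k.+1 phi
| calE_And k phi psi :
    calE n k.+1 phi -> calE n k.+1 psi -> calE n k.+1 (And phi psi)
| calE_Ex k x phi : calE n k.+1 phi -> calE n k.+1 (Ex x phi)
| calE_Or_gt k phi psi : k < n ->
    calE n k.+1 phi -> calE n k.+1 psi -> calE n k.+1 (Or phi psi)
| calE_Imp_gt k phi psi : k < n ->
    calU n k.+1 phi -> calE n k.+1 psi -> calE n k.+1 (Imp phi psi)
| calE_Or_eq k phi psi : n = k ->
    calE n k.+1 phi -> calE n k.+1 psi -> calE n k.+1 (Or phi psi)
| calE_Imp_eq k phi psi : n = k ->
    calD n k phi -> calE n k.+1 psi -> calE n k.+1 (Imp phi psi)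
| calE_Orl_lt k phi psi : n < k ->
    calE n k.+1 phi -> calE n n.+1 psi -> calE n k.+1 (Or phi psi)
| calE_Orr_lt k phi psi : n < k ->
    calE n n.+1 phi -> calE n k.+1 psi -> calE n k.+1 (Or phi psi)
| calE_Imp_lt k phi psi : n < k ->
    calD n n phi -> calE n k.+1 psi -> calE n k.+1 (Imp phi psi)
with calU (L : language) (n : nat) : nat -> formula L -> Prop :=
| calU_qf phi : quantifier_free phi -> calU n 0 phi
| calU_D k phi : calD n k phi -> calU n k.+1 phi
| calU_And k phi psi :
    calU n k.+1 phi -> calU n k.+1 psi -> calU n k.+1 (And phi psi)
| calU_All k x phi : calU n k.+1 phi -> calU n k.+1 (All x phi)
| calU_Or_gt k phi psi : k < n ->
    calU n k.+1 phi -> calU n k.+1 psi -> calU n k.+1 (Or phi psi)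
| calU_Imp_gt k phi psi : k < n ->
    calE n k.+1 phi -> calU n k.+1 psi -> calU n k.+1 (Imp phi psi)
| calU_Orl_eq k phi psi : n = k ->
    calU n k.+1 phi -> calD n k psi -> calU n k.+1 (Or phi psi)
| calU_Orr_eq k phi psi : n = k ->
    calD n k phi -> calU n k.+1 psi -> calU n k.+1 (Or phi psi)
| calU_Imp_eq k phi psi : n = k ->
    calE n k.+1 phi -> calU n k.+1 psi -> calU n k.+1 (Imp phi psi)
| calU_Orl_lt k phi psi : n < k ->
    calU n k.+1 phi -> calD n n psi -> calU n k.+1 (Or phi psi)
| calU_Orr_lt k phi psi : n < k ->
    calD n n phi -> calU n k.+1 psi -> calU n k.+1 (Or phi psi)
| calU_Imp_lt k phi psi : n < k ->
    calE n n.+1 phi -> calU n k.+1 psi -> calU n k.+1 (Imp phi psi)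
with calD (L : language) (n : nat) : nat -> formula L -> Prop :=
| calD_E k phi : calE n k phi -> calD n k phi
| calD_U k phi : calU n k phi -> calD n k phi.

Definition sign := bool.
Definition plus : sign := true.
Definition minus : sign := false.

Definition alternation_path (s : seq sign) : bool := sorted (fun a b => a != b) s.

(* i(s), with None for the undefined value. *)
Definition first_symbol (s : seq sign) : option sign := ohead s.

Definition perp (s : seq sign) : seq sign := map negb s.

(* A finite set of paths is given by a list, in which order and repetitions
   are irrelevant. *)
Fixpoint Alt (L : language) (phi : formula L) : seq (seq sign) :=
  if quantifier_free phi then [:: [::]] else
  match phi with
  | Bot | Atom _ _ => [:: [::]]
  | And phi1 phi2 | Or phi1 phi2 => Alt phi1 ++ Alt phi2
  | Imp phi1 phi2 => [seq perp s | s <- Alt phi1] ++ Alt phi2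
  | All _ phi1 =>
      [seq s <- Alt phi1 | first_symbol s == Some minus] ++
      [seq minus :: s | s <- Alt phi1 & first_symbol s != Some minus]
  | Ex _ phi1 =>
      [seq s <- Alt phi1 | first_symbol s == Some plus] ++
      [seq plus :: s | s <- Alt phi1 & first_symbol s != Some plus]
  end.

Lemma alternation_path_perp s : alternation_path s -> alternation_path (perp s).
Proof.
case: s => //= a s; elim: s a => //= b s IHs a /andP[neq_ab /IHs ->].
by move: neq_ab; case: a; case: b.
Qed.

Lemma alternation_path_cons a s :
  alternation_path s -> first_symbol s != Some a -> alternation_path (a :: s).
Proof. by case: s => //= b s ->; case: a; case: b. Qed.

(* So it is harmless that Alt is typed with arbitrary sequences of signs. *)
Lemma Alt_alternation_path (L : language) (phi : formula L) (s : seq sign) :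
  s \in Alt phi -> alternation_path s.
Proof.
elim: phi s => [|P a|f IHf g IHg|f IHf g IHg|f IHf g IHg|x f IHf|x f IHf] s /=;
  try case: ifP => _; rewrite ?inE ?mem_cat; try by move/eqP->.
- by case/orP; [apply: IHf | apply: IHg].
- by case/orP; [apply: IHf | apply: IHg].
- by case/orP; [case/mapP=> t /IHf /alternation_path_perp ? -> | apply: IHg].
- case/orP; first by rewrite mem_filter => /andP[_ /IHf].
  case/mapP=> t; rewrite mem_filter => /andP[ht /IHf pt] ->.
  exact: alternation_path_cons.
- case/orP; first by rewrite mem_filter => /andP[_ /IHf].
  case/mapP=> t; rewrite mem_filter => /andP[ht /IHf pt] ->.
  exact: alternation_path_cons.
Qed.

Definition deg (L : language) (phi : formula L) : nat :=
  \max_(s <- Alt phi) size s.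

Definition F_class (L : language) (k : nat) (phi : formula L) : Prop :=
  deg phi = k.

Definition E_class (L : language) (k : nat) (phi : formula L) : Prop :=
  match k with
  | 0 => F_class 0 phi
  | k'.+1 => F_class k'.+1 phi /\
      (forall s, s \in Alt phi -> size s = k'.+1 -> first_symbol s = Some plus)
  end.

Definition U_class (L : language) (k : nat) (phi : formula L) : Prop :=
  match k with
  | 0 => F_class 0 phi
  | k'.+1 => F_class k'.+1 phi /\
      (forall s, s \in Alt phi -> size s = k'.+1 -> first_symbol s = Some minus)
  end.

Definition E_plus (L : language) (k : nat) (phi : formula L) : Prop :=
  E_class k phi \/ exists2 i, i < k & F_class i phi.

Definition U_plus (L : language) (k : nat) (phi : formula L) : Prop :=
  U_class k phi \/ exists2 i, i < k & F_class i phi.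

(* Main.v *)
Require Import Defs.
From mathcomp Require Import all_boot zify.

(** Membership of [phi] in E_k^+ or U_k^+ means that every alternation path of
    [phi] is shorter than [k], or has length [k] and does not start with the
    wrong sign. This condition is decomposed by the connectives exactly as in
    the clauses for [k < n] generating the inductive classes. A quantifier of
    the wrong kind at level [k.+1] makes all paths start with the wrong sign,
    so that the formula is already in the dual class at level [k], which is
    the clause for D. *)

Definition path_bounded (b : sign) (k : nat) (s : seq sign) : bool :=
  (size s < k) || (size s == k) && (first_symbol s != Some (~~ b)).

Definition bounded (L : language) (b : sign) (k : nat) (phi : formula L) :=
  all (path_bounded b k) (Alt phi).

Arguments bounded {L} b k phi.

Lemma Alt_qf (L : language) (phi : formula L) :
  quantifier_free phi -> Alt phi = [:: [::]].
Proof. by case: phi => //= [f g|f g|f g] ->. Qed.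

(** At [k = 0] this relies on excluding the wrong first symbol instead of requiring the right one:
    the empty path has none. *)
Lemma path_bounded_nil b k : path_bounded b k [::].
Proof. by case: k. Qed.

Lemma path_bounded_perp b k s :
  path_bounded b k (perp s) = path_bounded (~~ b) k s.
Proof.
by rewrite /path_bounded size_map; case: s => //= -[] s; case: b.
Qed.

Lemma path_boundedW b b' k s : path_bounded b k s -> path_bounded b' k.+1 s.
Proof.
by rewrite /path_bounded ltnS => /orP[/ltnW ->|/andP[/eqP -> _]] //; rewrite leqnn.
Qed.

Lemma bounded_qf (L : language) b k (phi : formula L) :
  quantifier_free phi -> bounded b k phi.
Proof. by move=> qf; rewrite /bounded Alt_qf //= path_bounded_nil. Qed.

(** The sign becomes free because every path is now strictly shorter than the bound; this matches
    the clauses for D. *)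
Lemma boundedW (L : language) b b' k (phi : formula L) :
  bounded b k phi -> bounded b' k.+1 phi.
Proof. by apply: sub_all => s; apply: path_boundedW. Qed.

Lemma bounded_And (L : language) b k (f g : formula L) :
  bounded b k (And f g) = bounded b k f && bounded b k g.
Proof.
rewrite {1}/bounded /=; case: ifP => [/andP[qf qg]|_]; last exact: all_cat.
by rewrite !bounded_qf //= path_bounded_nil.
Qed.

Lemma bounded_Or (L : language) b k (f g : formula L) :
  bounded b k (Or f g) = bounded b k f && bounded b k g.
(* [Alt] treats [Or] and [And] alike, so the two statements are convertible. *)
Proof. exact: bounded_And. Qed.

Lemma bounded_Imp (L : language) b k (f g : formula L) :
  bounded b k (Imp f g) = bounded (~~ b) k f && bounded b k g.
Proof.
rewrite {1}/bounded /=; case: ifP => [/andP[qf qg]|_].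
  by rewrite !bounded_qf //= path_bounded_nil.
rewrite all_cat all_map; congr (_ && _).
by apply: eq_all => s /=; apply: path_bounded_perp.
Qed.

(** Indexing the quantifiers by the sign they put in front of paths lets dual cases share one
    proof. *)
Definition quant (L : language) (b : sign) : nat -> formula L -> formula L :=
  if b then @Ex L else @All L.

Arguments quant {L} b x f.

Lemma Alt_quant (L : language) b x (f : formula L) :
  Alt (quant b x f) = [seq s <- Alt f | first_symbol s == Some b] ++
    [seq b :: s | s <- Alt f & first_symbol s != Some b].
Proof. by case: b. Qed.

(** A nonempty path not starting with [b] starts with the wrong sign, so the bound [k.+1] forces its
    length to be at most [k], which leaves room for the new [b]. The empty path has room because the
    level is positive. *)
Lemma bounded_quant (L : language) b k x (f : formula L) :
  bounded b k.+1 (quant b x f) = bounded b k.+1 f.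
Proof.
rewrite /bounded Alt_quant all_cat all_map !all_filter -all_predI.
apply: eq_all => -[|a s]; rewrite /path_bounded /=; first by case: k b => [|k] [].
by rewrite !ltnS !eqSS leq_eqVlt; case: a b => -[];
  rewrite /= ?andbT ?andbF ?orbF // orbC.
Qed.

Lemma bounded_quantN (L : language) b k x (f : formula L) :
  bounded (~~ b) k.+1 (quant b x f) = bounded b k (quant b x f).
Proof.
rewrite /bounded; apply: eq_in_all => s.
have path_head t : path_bounded (~~ b) k.+1 (b :: t) = path_bounded b k (b :: t).
  rewrite /path_bounded /= negbK eqxx andbF orbF ltnS leq_eqVlt orbC.
  by case: b; rewrite andbT.
rewrite Alt_quant mem_cat => /orP[|/mapP[t _ ->]]; last exact: path_head.
by rewrite mem_filter; case: s => //= a s /andP[/eqP[->] _].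
Qed.

(** This prevents a quantified formula from being bounded at level 0 vacuously. *)
Lemma Alt_neq_nil (L : language) (phi : formula L) : Alt phi != [::].
Proof.
have cat_neq_nil (s t : seq (seq sign)) : s != [::] -> s ++ t != [::] by case: s.
have quant_neq_nil b x (f : formula L) : Alt f != [::] -> Alt (quant b x f) != [::].
  rewrite Alt_quant; case: (Alt f) => //= s t _.
  by case: ifP; rewrite // -size_eq0 size_cat addnS.
elim: phi => [|P a|f IHf g _|f IHf g _|f IHf g _|x f|x f] //=;
  try by case: ifP => // _; apply: cat_neq_nil => //; case: (Alt f) IHf.
- exact: (quant_neq_nil false x).
- exact: (quant_neq_nil true x).
Qed.

Lemma bounded0_quant (L : language) b c x (f : formula L) :
  bounded b 0 (quant c x f) = false.
Proof.
rewrite /bounded Alt_quant; case: (Alt f) (Alt_neq_nil L f) => //= s t _.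
case: ifP => //=; first by case: s.
by move=> _; rewrite all_cat /= andbF.
Qed.

Lemma bounded0 (L : language) b (phi : formula L) :
  bounded b 0 phi = quantifier_free phi.
Proof.
elim: phi b => [|P a|f IHf g IHg|f IHf g IHg|f IHf g IHg|x f _|x f _] b;
  rewrite ?bounded_And ?bounded_Or ?bounded_Imp ?IHf ?IHg //.
- exact: (bounded0_quant L b false).
- exact: (bounded0_quant L b true).
Qed.

Lemma plus_bounded (L : language) b k (phi : formula L) :
  (if b then E_plus k phi else U_plus k phi) <-> bounded b k phi.
Proof.
have size_le s : s \in Alt phi -> size s <= deg phi.
  by move=> sA; apply: leq_bigmax_seq.
split=> [plus_phi | bounded_phi].
  apply/allP => s sA; have := size_le s sA; rewrite /path_bounded.
  (* The guard [0 < k] is there because the classes at level 0 put no condition on first symbols. *)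
  have [lt_deg le_s|[deg_phi first_phi]] : deg phi < k \/ deg phi = k /\
      (0 < k -> size s = k -> first_symbol s = Some b).
  - case: b plus_phi => -[class_phi|[i lt_ik deg_i]]; try by left; rewrite deg_i.
    + by right; case: k class_phi => [|k] // [? first_k]; split=> // _; apply: first_k.
    + by right; case: k class_phi => [|k] // [? first_k]; split=> // _; apply: first_k.
  - by rewrite (leq_ltn_trans le_s).
  rewrite deg_phi leq_eqVlt => /orP[/eqP sk|-> //].
  rewrite sk ltnn eqxx /=; case: (posnP k) => [k0|k_gt0].
    by case: s sA sk {first_phi} => //= a s; rewrite k0.
  by rewrite first_phi //; case: b {plus_phi first_phi}.
have : deg phi <= k.
  apply/bigmax_leqP_seq => s sA _.
  by case/orP: (allP bounded_phi s sA) => [/ltnW //|/andP[/eqP -> _]].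
rewrite leq_eqVlt => /orP[/eqP deg_phi|lt_deg]; last first.
  by case: b {bounded_phi}; right; exists (deg phi).
(* A path of positive length has a first symbol, so not being the wrong one makes it the right
   one. *)
have first_phi s : s \in Alt phi -> size s = k -> 0 < k -> first_symbol s = Some b.
  move=> sA sk; have := allP bounded_phi s sA.
  rewrite /path_bounded sk ltnn eqxx /=.
  by case: s sk {sA} => [<- //|a s _] /=; case: a b {bounded_phi} => -[].
case: b {bounded_phi} first_phi => first_phi; left;
  case: k deg_phi first_phi => //= k deg_phi first_phi; split=> // s sA sk;
  exact: first_phi.
Qed.

Scheme calE_mut := Minimality for calE Sort Prop
  with calU_mut := Minimality for calU Sort Prop
  with calD_mut := Minimality for calD Sort Prop.
Combined Scheme cal_mutind from calE_mut, calU_mut, calD_mut.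

(** The [calD] part is stated one level up, where both signs hold whichever class the formula came
    from. *)
Lemma cal_bounded (L : language) n :
  (forall k (phi : formula L), calE n k phi -> k <= n -> bounded true k phi) /\
  (forall k (phi : formula L), calU n k phi -> k <= n -> bounded false k phi) /\
  (forall k (phi : formula L), calD n k phi -> k < n ->
     forall b, bounded b k.+1 phi).
Proof.
apply: cal_mutind; try by move=> *; apply: bounded_qf.
(* The clauses for [n <= k] do not occur at levels [k.+1 <= n]. *)
all: try by move=> k *; exfalso; lia.
- move=> k phi _ IH lt_kn; exact: IH.
- by move=> k phi psi _ IHf _ IHg le_kn; rewrite bounded_And IHf ?IHg.
- by move=> k x phi _ IH le_kn; rewrite (bounded_quant L true) IH.
- by move=> k phi psi _ _ IHf _ IHg le_kn; rewrite bounded_Or IHf ?IHg.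
- by move=> k phi psi _ _ IHf _ IHg le_kn; rewrite bounded_Imp IHf ?IHg.
- move=> k phi _ IH lt_kn; exact: IH.
- by move=> k phi psi _ IHf _ IHg le_kn; rewrite bounded_And IHf ?IHg.
- by move=> k x phi _ IH le_kn; rewrite (bounded_quant L false) IH.
- by move=> k phi psi _ _ IHf _ IHg le_kn; rewrite bounded_Or IHf ?IHg.
- by move=> k phi psi _ _ IHf _ IHg le_kn; rewrite bounded_Imp IHf ?IHg.
- by move=> k phi _ IH /ltnW le_kn b; apply: boundedW (IH le_kn).
- by move=> k phi _ IH /ltnW le_kn b; apply: boundedW (IH le_kn).
Qed.

Lemma bounded_cal (L : language) n k : k <= n ->
  forall b (phi : formula L),
  bounded b k phi -> if b then calE n k phi else calU n k phi.
Proof.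
elim: k => [_ [] phi|k IHk lt_kn b phi]; rewrite ?bounded0.
- exact: calE_qf.
- exact: calU_qf.
(* The clauses for D lead from either class at level [k] to either class at level [k.+1]. *)
have lower b' c (f : formula L) :
    bounded b' k f -> if c then calE n k.+1 f else calU n k.+1 f.
  move=> /(IHk (ltnW lt_kn)) cal_f; have : calD n k f.
    by case: b' cal_f; [left | right].
  by case: c; [apply: calE_D | apply: calU_D].
(* The level stays fixed in this inner induction, while the sign varies because [Imp] flips it. *)
elim: phi b => [|P a|f IHf g IHg|f IHf g IHg|f IHf g IHg|x f IHf|x f IHf] b.
- by move=> _; apply: (lower b); apply: bounded_qf.
- by move=> _; apply: (lower b); apply: bounded_qf.
- rewrite bounded_And => /andP[/IHf + /IHg].
  by case: b; [apply: calE_And | apply: calU_And].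
- rewrite bounded_Or => /andP[/IHf + /IHg].
  by case: b; [apply: calE_Or_gt | apply: calU_Or_gt].
- rewrite bounded_Imp => /andP[/IHf + /IHg].
  by case: b; [apply: calE_Imp_gt | apply: calU_Imp_gt].
(* Only [calE_D] can yield a universal formula in [calE] at a positive level, hence the descent to
   level [k]. *)
- case: b; first by rewrite (bounded_quantN L false); apply: (lower false true).
  by rewrite (bounded_quant L false) => /IHf; apply: calU_All.
- case: b; last by rewrite (bounded_quantN L true); apply: (lower true false).
  by rewrite (bounded_quant L true) => /IHf; apply: calE_Ex.
Qed.

Theorem proposition2p10 (L : language) (n k : nat) (hkn : k <= n) :
  (forall phi : formula L, E_plus k phi <-> calE n k phi) /\
  (forall phi : formula L, U_plus k phi <-> calU n k phi).
Proof.
have [calE_bounded [calU_bounded _]] := cal_bounded L n.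
split=> phi; split.
- by move/(plus_bounded L true)/(bounded_cal L n k hkn).
- by move/calE_bounded/(_ hkn)/(plus_bounded L true).
- by move/(plus_bounded L false)/(bounded_cal L n k hkn).
- by move/calU_bounded/(_ hkn)/(plus_bounded L false).
Qed.
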